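(* Let $P\in\mathbb{C}[y]$ with $\deg P\geq 2$, $\delta\in\mathbb{C}\setminus\{0\}$, $h_1(x,y)=(y,P(y)-\delta x)$, $\theta\in(0,2\pi)\setminus\{\frac{\pi}{2},\pi,\frac{3\pi}{2}\}$, $R_\theta$ the linear map of $\mathbb{C}^2$ with matrix $\begin{pmatrix}\cos\theta&-\sin\theta\\ \sin\theta&\cos\theta\end{pmatrix}$, $h_2=R_\theta^{-1}\circ h_1\circ R_\theta$ and $G=\langle h_1,h_2\rangle$. Let $\nu=a_1\delta_{h_1}+a_2\delta_{h_2}+a_3\delta_{h_1^{-1}}+a_4\delta_{h_2^{-1}}$ with $a_i>0$ for each $i$ and $\sum_{i=1}^4a_i=1$. If $\mu$ is a $\nu$-stationary Borel probability measure on $\mathbb{C}^2$, then $\operatorname{supp}\mu$ is compact.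
   Context: A Borel probability measure $\mu$ on $\mathbb{C}^2$ is $\nu$-stationary if $\mu=\int_G g_*\mu\,d\nu(g)$, i.e. here $\mu=a_1(h_1)_*\mu+a_2(h_2)_*\mu+a_3(h_1^{-1})_*\mu+a_4(h_2^{-1})_*\mu$; equivalently $\int f\,d\mu=\int_G\int f(g\cdot x)\,d\mu(x)\,d\nu(g)$ for all compactly supported continuous $f$. *)

(* Defs.v *)
From HB Require Import structures.
From mathcomp Require Import all_boot all_order all_algebra.
From mathcomp Require Import complex.
From mathcomp Require Import all_classical all_reals all_analysis.
Import numFieldNormedType.Exports.
Set Implicit Arguments. Unset Strict Implicit. Unset Printing Implicit Defensive.
Import Order.TTheory GRing.Theory Num.Theory.
Local Open Scope classical_set_scope.
Local Open Scope ring_scope.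
Local Open Scope complex_scope.

(* C^2 is modelled as (R*R)*(R*R): a point (x,y) in C^2 with x = a+ib,
   y = c+id is ((a,b),(c,d)).  This type carries the product topology
   and the product sigma-algebra of Borel sets (= Borel sets of R^4). *)
Notation C2 R := ((R * R) * (R * R))%type.

Section Maps.
Variable R : realType.

Definition toC (p : R * R) : R[i] := p.1 +i* p.2.
Definition ofC (z : R[i]) : R * R := (complex.Re z, complex.Im z).
Definition pt (x y : R[i]) : C2 R := (ofC x, ofC y).

Definition h1 (P : {poly R[i]}) (delta : R[i]) (p : C2 R) : C2 R :=
  let x := toC p.1 in let y := toC p.2 in pt y (P.[y] - delta * x).

Definition h1inv (P : {poly R[i]}) (delta : R[i]) (p : C2 R) : C2 R :=
  let x := toC p.1 in let y := toC p.2 in pt ((P.[x] - y) / delta) x.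

Definition rot (theta : R) (p : C2 R) : C2 R :=
  let x := toC p.1 in let y := toC p.2 in
  let c := (cos theta)%:C in let s := (sin theta)%:C in
  pt (c * x - s * y) (s * x + c * y).

Definition rotinv (theta : R) (p : C2 R) : C2 R :=
  let x := toC p.1 in let y := toC p.2 in
  let c := (cos theta)%:C in let s := (sin theta)%:C in
  pt (c * x + s * y) (- s * x + c * y).

Definition h2 P delta theta : C2 R -> C2 R :=
  rotinv theta \o h1 P delta \o rot theta.
Definition h2inv P delta theta : C2 R -> C2 R :=
  rotinv theta \o h1inv P delta \o rot theta.

Definition stationary (P : {poly R[i]}) (delta : R[i]) (theta a1 a2 a3 a4 : R)
    (mu : set (C2 R) -> \bar R) : Prop :=
  forall A : set (C2 R), measurable A ->
    mu A = (a1%:E * mu (h1 P delta @^-1` A) + a2%:E * mu (h2 P delta theta @^-1` A)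
          + a3%:E * mu (h1inv P delta @^-1` A) + a4%:E * mu (h2inv P delta theta @^-1` A))%E.

Definition supp (mu : set (C2 R) -> \bar R) : set (C2 R) :=
  [set x | forall U : set (C2 R), open U -> U x -> (0 < mu U)%E].

End Maps.

(* Main.v *)
Require Import Defs.
From HB Require Import structures.
From mathcomp Require Import all_boot all_order all_algebra.
From mathcomp Require Import complex.
From mathcomp Require Import ring lra.
From mathcomp Require Import all_classical all_reals all_analysis.
From mathcomp Require Import measurable_realfun.
Import numFieldNormedType.Exports.
Import Order.TTheory GRing.Theory Num.Theory.
Local Open Scope classical_set_scope.
Local Open Scope ring_scope.

(* Far from the origin, each of the four maps at least doubles N(x,y) = |x|^2 +
   |y|^2 except near one complex line; as theta is not a multiple of pi/2 these
   four lines are distinct, so at most one letter fails to expand.  Greedy descent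
   of N along the G-orbit therefore never backtracks, and the orbit looks like
   the tree of the free group.  Give each letter i a weight q_i < 1 and let psi(p)
   be the product of the weights along the greedy descent from p (the empty
   product at a local minimum, or in the ball N <= M).  For suitable q_i, an
   upper estimate for the hitting probabilities of the walk on the tree, psi is
   superharmonic, strictly so on N > M.  Integrating against the stationary
   probability mu gives mu(N > M) = 0. *)

(** * Weights along greedy descent *)

Section Descent.
Context {R : realType} {T : Type} {I : finType}.
Variables (s : I -> T -> T) (inv : I -> I) (N : T -> R) (M : R) (q : I -> R).
Hypotheses (invK : involutive inv) (sK : forall i, cancel (s i) (s (inv i))).
Hypothesis M_gt0 : 0 < M.
Hypothesis expand : forall p i j, M < N p -> i != j ->
  N (s i p) <= 2 * N p -> 2 * N p < N (s j p).
Hypothesis q01 : forall i, 0 < q i < 1.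

(** The index [i] is the last letter of the climb up to [p]: the descent applies [inv i]. *)
Definition descends i p := (M < N p) && (N (s (inv i) p) < N p).

(** By [descends_uniq] at most one factor differs from 1, so the product selects the greedy step in
    a visibly measurable way; [n] caps the number of steps. *)
Fixpoint truncated_weight n p : R :=
  if n is n'.+1 then
    \prod_i (if descends i p then q i * truncated_weight n' (s (inv i) p) else 1)
  else 1.

Lemma expandV p i j : M < N p -> i != j -> N (s j p) <= 2 * N p ->
  2 * N p < N (s i p).
Proof.
by move=> Mp ij sj; apply: (expand p j i) => //; rewrite eq_sym.
Qed.

Lemma descends_contract i p : descends i p -> N (s (inv i) p) <= 2 * N p.
Proof. by case/andP => Mp lt; have := M_gt0; lra. Qed.

(** Two descending letters would have two inverses failing to double [N], and [expand] allows only
    one. *)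
Lemma descends_uniq i j p : descends i p -> descends j p -> i = j.
Proof.
move=> di dj; apply: (can_inj invK); apply/eqP/negP => /negP ij.
have /andP[Mp _] := di.
have := expand p _ _ Mp ij (descends_contract _ _ di).
by rewrite ltNge descends_contract.
Qed.

Lemma truncated_weight_descends i p n : descends i p ->
  truncated_weight n.+1 p = q i * truncated_weight n (s (inv i) p).
Proof.
move=> di; rewrite /= (bigD1 i)//= di big1 ?mulr1// => j ji.
by case: ifP => // dj; rewrite (descends_uniq _ _ _ dj di) eqxx in ji.
Qed.

Lemma truncated_weight_minimal p n : (forall i, ~~ descends i p) ->
  truncated_weight n p = 1.
Proof.
by case: n => // n ndi; rewrite /= big1// => i _; rewrite (negbTE (ndi i)).
Qed.

Lemma truncated_weight_gt0_le1 n p : 0 < truncated_weight n p <= 1.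
Proof.
elim: n p => [|n IH] p; first by rewrite /= ltr01 lexx.
case: (pselect (exists i, descends i p)) => [[i di]|ndi].
  rewrite (truncated_weight_descends i)//; have /andP[q0 q1] := q01 i.
  have /andP[w0 w1] := IH (s (inv i) p).
  by rewrite mulr_gt0//= mulr_ile1 // ltW.
rewrite truncated_weight_minimal ?ltr01 ?lexx// => i; apply/negP => di.
by apply: ndi; exists i.
Qed.

(* Undoing a descent step climbs, so by [expand] the step that climbs back
   at least doubles [N]: a descent of length k+1 starts above [2 ^ k * M]. *)
Lemma truncated_weight_stable k p n m : N p <= M * 2 ^+ k ->
  (k < n)%N -> (k < m)%N -> truncated_weight n p = truncated_weight m p.
Proof.
elim: k p n m => [|k IH] p [//|n] [//|m] Np kn km.
  rewrite !truncated_weight_minimal// => i; rewrite /descends ltNge.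
  1,2: by rewrite expr0 mulr1 in Np; rewrite Np.
case: (pselect (exists i, descends i p)) => [[i di]|ndi]; last first.
  by rewrite !truncated_weight_minimal// => i; apply/negP => di; apply: ndi; exists i.
rewrite !(truncated_weight_descends i)//; congr (_ * _).
case: (pselect (exists j, descends j (s (inv i) p))) => [[j dj]|ndj]; last first.
  by rewrite !truncated_weight_minimal// => j; apply/negP => dj; apply: ndj; exists j.
apply: IH => //.
have /andP[Mp lt] := di; have /andP[Mq lt'] := dj.
have sq : s i (s (inv i) p) = p by have := sK (inv i) p; rewrite invK.
have neq : i != inv j.
  by apply: contraTneq lt' => <-; rewrite sq -leNgt ltW.
have := expandV _ _ _ Mq neq (descends_contract _ _ dj).
by rewrite sq; rewrite exprS in Np; lra.
Qed.

Lemma truncated_weight_cvg p :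
  exists k, forall n, (k <= n)%N -> truncated_weight n p = truncated_weight k p.
Proof.
have [k Hk] : exists k, N p <= M * 2 ^+ k.
  exists (Num.truncn (N p / M)).+1.
  rewrite mulrC -ler_pdivrMr//.
  apply: le_trans (ltW (truncnS_gt _)) _.
  by rewrite -natrX ler_nat ltnW// ltn_expl.
by exists k.+1 => n kn; apply: (truncated_weight_stable k).
Qed.

Definition weight p := truncated_weight (sval (cid (truncated_weight_cvg p))) p.

Lemma weightE p :
  exists k, forall n, (k <= n)%N -> weight p = truncated_weight n p.
Proof.
rewrite /weight; case: cid => k Hk /=; exists k => n kn.
by rewrite Hk.
Qed.

Lemma weight_gt0_le1 p : 0 < weight p <= 1.
Proof. exact: truncated_weight_gt0_le1. Qed.

Lemma weight_descends i p : descends i p ->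
  weight p = q i * weight (s (inv i) p).
Proof.
move=> di; have [k Hk] := weightE p; have [l Hl] := weightE (s (inv i) p).
rewrite (Hl (maxn k l)) ?leq_maxr// (Hk (maxn k l).+1) ?leqW ?leq_maxl//.
exact: truncated_weight_descends.
Qed.

Lemma weight_minimal p : (forall i, ~~ descends i p) -> weight p = 1.
Proof. exact: truncated_weight_minimal. Qed.

(** The inverse of [j] leads from [s j p] back down to [p], so it is the greedy step there. *)
Lemma weight_climb j p : M < N p -> 2 * N p < N (s j p) ->
  weight (s j p) = q j * weight p.
Proof.
move=> Mp lt; have dj : descends j (s j p).
  by rewrite /descends sK; have := M_gt0; apply/implyP; lra.
by rewrite (weight_descends _ _ dj) sK.
Qed.

(** Only [e] may fail to expand. Either [s e p] is the greedy step from [p] and equality holds, or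
    [p] is a local minimum of weight 1. The letter [e0] stands in when all letters expand. *)
Lemma weight_step p (e0 : I) : M < N p ->
  exists e, weight (s e p) <= weight p / q (inv e) /\
    forall j, j != e -> weight (s j p) = q j * weight p.
Proof.
move=> Mp.
have [e He] : exists e, forall j, j != e -> 2 * N p < N (s j p).
  case: (pselect (exists e, N (s e p) <= 2 * N p)) => [[e He]|ne].
    by exists e => j je; apply: (expand p e) => //; rewrite eq_sym.
  by exists e0 => j _; rewrite ltNge; apply/negP => lej; apply: ne; exists j.
exists e; split => [|j je]; last exact: weight_climb (He j je).
have /andP[q0 q1] := q01 (inv e).
rewrite ler_pdivlMr// mulrC.
case: (boolP (descends (inv e) p)) => [de|nde].
  by rewrite (weight_descends _ _ de) invK.
rewrite (@weight_minimal p) => [|i].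
  have /andP[w0 w1] := weight_gt0_le1 (s e p).
  by rewrite mulr_ile1 // ltW.
apply/negP => di; case: (eqVneq (inv i) e) => [ie|/He].
  by rewrite -ie invK di in nde.
by rewrite ltNge descends_contract.
Qed.

Variable a : I -> R.
Hypothesis a_gt0 : forall i, 0 < a i.
Hypothesis a_sum1 : \sum_i a i = 1.
Hypothesis drift : forall e, a e / q (inv e) + \sum_(j | j != e) a j * q j < 1.

(** By [weight_step], the average divided by [weight p] is at most the left side of [drift] at the
    exceptional letter. *)
Lemma weight_strict_superharmonic p : M < N p ->
  \sum_i a i * weight (s i p) < weight p.
Proof.
move=> Mp.
have [e0 _] : exists e0 : I, True.
  case: (pselect (exists e0 : I, True)) => // nI.
  move: a_sum1; rewrite big1 => [/esym/eqP|i _]; first by rewrite oner_eq0.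
  by exfalso; apply: nI; exists i.
have [e [we wj]] := weight_step _ e0 Mp.
have /andP[w0 w1] := weight_gt0_le1 p.
rewrite (bigD1 e)//=.
under eq_bigr => j je do rewrite (wj j je) mulrA.
rewrite -mulr_suml.
have := drift e; rewrite -(ltr_pM2r w0) mul1r; apply: le_lt_trans.
rewrite [leRHS]mulrDl lerD2r -mulrA ler_pM2l//.
by rewrite mulrC.
Qed.

(** Where [N p <= M] the weight has its maximal value 1, which no average exceeds. *)
Lemma weight_superharmonic p : \sum_i a i * weight (s i p) <= weight p.
Proof.
have [Mp|Mp] := ltP M (N p); first exact/ltW/weight_strict_superharmonic.
rewrite (@weight_minimal p) => [|i]; last by rewrite /descends ltNge Mp.
rewrite -a_sum1; apply: ler_sum => i _.
by rewrite ger_pMr//; have /andP[] := weight_gt0_le1 (s i p).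
Qed.

End Descent.

(** * Vanishing of a stationary measure far out *)

Section Stationary.
Context {R : realType} {d : measure_display} {T : measurableType d} {I : finType}.
Variables (s : I -> T -> T) (inv : I -> I) (N : T -> R) (M : R) (q a : I -> R).
Variable mu : probability T R.
Hypotheses (invK : involutive inv) (sK : forall i, cancel (s i) (s (inv i))).
Hypothesis M_gt0 : 0 < M.
Hypothesis expand : forall p i j, M < N p -> i != j ->
  N (s i p) <= 2 * N p -> 2 * N p < N (s j p).
Hypothesis q01 : forall i, 0 < q i < 1.
Hypothesis a_gt0 : forall i, 0 < a i.
Hypothesis a_sum1 : \sum_i a i = 1.
Hypothesis drift : forall e, a e / q (inv e) + \sum_(j | j != e) a j * q j < 1.
Hypothesis ms : forall i, measurable_fun setT (s i).
Hypothesis mN : measurable_fun setT N.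
Hypothesis stat : forall f : T -> R, measurable_fun setT f ->
  (forall x, 0 <= f x <= 1) ->
  (\int[mu]_x (f x)%:E = \int[mu]_x (\sum_i a i * f (s i x))%:E)%E.

Let W := weight s inv N M q invK sK M_gt0 expand.

Lemma measurable_descends i : measurable_fun setT (descends s inv N M i).
Proof.
apply: measurable_and; apply: measurable_fun_ltr => //.
exact: measurableT_comp.
Qed.

Lemma measurable_truncated_weight n :
  measurable_fun setT (truncated_weight s inv N M q n).
Proof.
elim: n => [|n IH]; first exact: measurable_cst.
apply: measurable_prod => i _.
apply: measurable_fun_ifT => //; first exact: measurable_descends.
by apply: measurable_funM => //; exact: measurableT_comp.
Qed.

Lemma measurable_weight : measurable_fun setT W.
Proof.
apply: (@measurable_fun_cvg _ _ _ setT (truncated_weight s inv N M q) W) => [n|x _].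
  exact: measurable_truncated_weight.
apply: cvg_near_cst; have [k Hk] := weightE s inv N M q invK sK M_gt0 expand x.
by exists k => // n /= kn; rewrite /W (Hk n kn).
Qed.

(** By stationarity the nonnegative function [W - QW] has integral 0, so it vanishes almost
    everywhere; yet it is positive wherever [M < N p]. *)
Lemma stationary_null : mu [set p | M < N p] = 0%E.
Proof.
have W01 x : 0 < W x <= 1 by exact: weight_gt0_le1.
pose QW x := \sum_i a i * W (s i x).
have mQW : measurable_fun setT QW.
  apply: measurable_sum => i; apply: measurable_funM => //.
  by apply: measurableT_comp => //; exact: measurable_weight.
have QWW x : QW x <= W x by exact: weight_superharmonic.
have QW0 x : 0 <= QW x.
  by apply: sumr_ge0 => i _; rewrite mulr_ge0 ?ltW//; have /andP[] := W01 (s i x).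
have bint (f : T -> R) : measurable_fun setT f -> (forall x, 0 <= f x <= 1) ->
    mu.-integrable setT (EFin \o f).
  move=> mf f01; apply: measurable_bounded_integrable => //.
    by rewrite [X in (X < _)%E](@probability_setT _ _ _ mu) ltry.
  exists 1; split => // y y1 x _ /=.
  have /andP[f0 f1] := f01 x.
  by rewrite ger0_norm//; exact: le_trans (ltW y1).
have iW : mu.-integrable setT (EFin \o W).
  by apply: bint => [|x]; [exact: measurable_weight|have /andP[/ltW-> ->] := W01 x].
have iQW : mu.-integrable setT (EFin \o QW).
  apply: bint => // x; rewrite QW0/=; apply: le_trans (QWW x) _.
  by have /andP[] := W01 x.
have : (\int[mu]_x ((W x)%:E - (QW x)%:E) = 0)%E.
  rewrite integralB_EFin// stat ?subee//; first exact: integrable_fin_num.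
    exact: measurable_weight.
  by move=> x; have /andP[/ltW-> ->] := W01 x.
have mF : measurable [set p | M < N p].
  have -> : [set p | M < N p] = N @^-1` `]M, +oo[.
    by apply/seteqP; split => p /=; rewrite in_itv/= andbT.
  by rewrite -[X in measurable X]setTI; exact: mN.
have mD : measurable_fun setT (fun x => (W x)%:E - (QW x)%:E)%E.
  by apply/measurable_EFinP/measurable_funB => //; exact: measurable_weight.
move=> int0.
have /(ae_eq_integral_abs _ measurableT mD) [Z [mZ Z0 HZ]] :
    (\int[mu]_x `|(W x)%:E - (QW x)%:E| = 0)%E.
  rewrite -[RHS]int0; apply: eq_integral => x _.
  by rewrite gee0_abs// -EFinB lee_fin subr_ge0.
apply: (subset_measure0 mF mZ _ Z0) => p Mp; apply: HZ => /= /(_ Logic.I).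
move/eqP; rewrite -EFinB eqe subr_eq0 => /eqP.
have := @weight_strict_superharmonic _ _ _ s inv N M q invK sK M_gt0 expand q01
  a a_gt0 a_sum1 drift p Mp.
by rewrite -/(QW p) -/(W p) => lt eq; rewrite eq ltxx in lt.
Qed.

End Stationary.

(** * Choice of the letter weights *)

Section Weights.
Variable R : realType.

(* In a letter [e], the bit [e.1] selects [h2] over [h1], and [e.2] the inverse. *)
Definition letter_inv (e : bool * bool) := (e.1, ~~ e.2).

Lemma letter_invK : involutive letter_inv.
Proof. by case=> b c; rewrite /letter_inv /= negbK. Qed.

(** Grouping around an arbitrary [e] spares a case analysis in the drift estimate. *)
Lemma sum_letters (F : bool * bool -> R) e :
  \sum_i F i = F e + F (letter_inv e)
             + (F (~~ e.1, e.2) + F (letter_inv (~~ e.1, e.2))).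
Proof.
have -> : \sum_i F i = \sum_b \sum_c F (b, c).
  by rewrite pair_bigA; apply: eq_bigr => -[].
rewrite !big_bool /=.
by case: e => -[] [] /=; rewrite /letter_inv /=; ring.
Qed.

(* The first-order choice [q e = 1 - eps / a (inv e)] works because
   [t + 1 / t >= 2] for the ratio [t] of the other two weights. *)
Lemma drift_weights (a : bool * bool -> R) :
  (forall e, 0 < a e) -> \sum_e a e = 1 ->
  exists q, (forall e, 0 < q e < 1) /\
    forall e, a e / q (letter_inv e) + \sum_(j | j != e) a j * q j < 1.
Proof.
move=> a0 a1.
(* Half the least mass keeps each [q e] positive and gives [eps <= x / 2], needed for [h1] below. *)
have [eps [eps0 He]] : exists eps, 0 < eps /\ forall e, eps <= a e / 2.
  exists (\big[Order.min/1]_e a e / 2); split.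
    by rewrite divr_gt0//; apply: lt_bigmin.
  by move=> e; rewrite ler_pM2r ?invr_gt0//; apply: bigmin_le_cond.
exists (fun e => 1 - eps / a (letter_inv e)); split.
  move=> e; have e0 := a0 (letter_inv e).
  rewrite gtrBl divr_gt0// andbT subr_gt0 ltr_pdivrMr// mul1r.
  by have := He (letter_inv e); lra.
move=> e; rewrite letter_invK.
pose F j := a j * (1 - eps / a (letter_inv j)).
have -> : \sum_(j | j != e) a j * (1 - eps / a (letter_inv j)) = \sum_j F j - F e.
  by rewrite [in RHS](bigD1 e)//= addrAC subrr add0r.
rewrite (sum_letters F e) /F !letter_invK.
move: a1; rewrite (sum_letters a e).
set x := a e; set y := a (letter_inv e); set z := a (~~ e.1, e.2).
set w := a (letter_inv _) => a1.
have x0 : 0 < x by exact: a0.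
have y0 : 0 < y by exact: a0.
have z0 : 0 < z by exact: a0.
have w0 : 0 < w by exact: a0.
have ex : eps <= x / 2 by exact: He.
have h1 : x / (1 - eps / x) <= x + 2 * eps.
  have -> : x / (1 - eps / x) = x ^+ 2 / (x - eps).
    have xe : 0 < x - eps by lra.
    by field; rewrite ?gt_eqF//=.
  rewrite ler_pdivrMr; last lra.
  have : 0 <= eps * (x - 2 * eps) by rewrite mulr_ge0// ?subr_ge0; lra.
  by nra.
have h2 : 2 * eps <= z * (eps / w) + w * (eps / z).
  have -> : z * (eps / w) + w * (eps / z) = 2 * eps + eps * (z - w) ^+ 2 / (z * w).
    by field; rewrite !gt_eqF.
  rewrite lerDl; apply: divr_ge0; last exact/ltW/mulr_gt0.
  by apply: mulr_ge0; [exact: ltW|exact: sqr_ge0].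
(* The excess [2 * eps] of [h1] is offset by [h2]; strictness comes from this loss in the term of
   the inverse letter. *)
have h3 : 0 < y * (eps / x) by rewrite mulr_gt0// divr_gt0.
by lra.
Qed.

End Weights.

(** * Growth of complex polynomials *)

Section Growth.
Variable R : realType.
Local Notation normc := (@Normc.normc R).

Lemma normc_triangle (x y : R[i]) : normc (x + y) <= normc x + normc y.
Proof. by rewrite -lecR rmorphD/=; exact: (@ler_normD _ R[i]). Qed.

Lemma normc_opp (x : R[i]) : normc (- x) = normc x.
Proof. by case: x => a b /=; rewrite !sqrrN. Qed.

Lemma normc_ge0 (x : R[i]) : 0 <= normc x.
Proof. by case: x => a b; exact: sqrtr_ge0. Qed.

Lemma normc_subr (x y : R[i]) : normc x <= normc (x - y) + normc y.
Proof. by rewrite -{1}(subrK y x); exact: normc_triangle. Qed.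

Lemma normc_sqr (x : R[i]) : normc x ^+ 2 = complex.Re x ^+ 2 + complex.Im x ^+ 2.
Proof. by case: x => a b /=; rewrite sqr_sqrtr// addr_ge0 ?sqr_ge0. Qed.

(** Induction on the Horner form: beyond [(1 + normc c) / k] the term [p.[z] * z] has modulus at
    least [1 + normc c], and adding [c] leaves at least 1. *)
Lemma poly_bounded_below (p : {poly R[i]}) : p != 0 ->
  exists k C, 0 < k /\ forall z, C <= normc z -> k <= normc p.[z].
Proof.
elim/poly_ind: p => [|p c IH]; first by rewrite eqxx.
have [->|p0] := eqVneq p 0.
  rewrite mul0r add0r polyC_eq0 => c0; exists (normc c), 0; split.
    rewrite lt_neqAle normc_ge0 andbT eq_sym.
    by apply: contra c0 => /eqP/Normc.eq0_normc ->.
  by move=> z _; rewrite hornerC.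
move=> _; have [k [C [k0 Hk]]] := IH p0.
exists 1, (Num.max C ((1 + normc c) / k)); split => // z.
rewrite ge_max => /andP[/Hk kz]; rewrite ler_pdivrMr// => Cz.
rewrite hornerMXaddC.
have := normc_subr (p.[z] * z) (- c); rewrite opprK normc_opp Normc.normcM.
have : normc z * k <= normc p.[z] * normc z.
  by rewrite mulrC ler_wpM2r// normc_ge0.
lra.
Qed.

(** One Horner step suffices: the nonzero quotient is bounded below far out, and the factor [z]
    makes the product large. *)
Lemma poly_unbounded (p : {poly R[i]}) (K : R) : (1 < size p)%N ->
  exists C, forall z, C <= normc z -> K <= normc p.[z].
Proof.
elim/poly_ind: p => [|p c _]; first by rewrite size_poly0.
rewrite size_MXaddC; have [->|p0 _] := eqVneq p 0.
  by rewrite size_poly0; case: ifP.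
have [k [C [k0 Hk]]] := poly_bounded_below _ p0.
exists (Num.max C ((K + normc c) / k)) => z.
rewrite ge_max => /andP[/Hk kz]; rewrite ler_pdivrMr// => Cz.
rewrite hornerMXaddC.
have := normc_subr (p.[z] * z) (- c); rewrite opprK normc_opp Normc.normcM.
have : normc z * k <= normc p.[z] * normc z.
  by rewrite mulrC ler_wpM2r// normc_ge0.
lra.
Qed.

(** Applied to the Horner quotient, [poly_unbounded] gives slope [K] far out; [C] absorbs the
    constant term and the remaining disc. *)
Lemma poly_superlinear (p : {poly R[i]}) (K : R) : (2 < size p)%N -> 0 <= K ->
  exists C, forall z, K * normc z <= normc p.[z] + C.
Proof.
elim/poly_ind: p => [|p c _]; first by rewrite size_poly0.
rewrite size_MXaddC => sp K0.
have {}sp : (1 < size p)%N by move: sp; case: ifP.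
have [C HC] := poly_unbounded p K sp.
exists (normc c + K * Num.max C 0) => z.
have h : normc (p.[z] * z) <= normc (p * 'X + c%:P).[z] + normc c.
  rewrite hornerMXaddC.
  by have := normc_subr (p.[z] * z) (- c); rewrite opprK normc_opp.
have z0 := normc_ge0 z.
have [Cz|/ltW zC] := leP C (normc z).
  have : K * normc z <= normc (p.[z] * z).
    by rewrite Normc.normcM ler_wpM2r// HC.
  have : 0 <= K * Num.max C 0 by rewrite mulr_ge0// le_max lexx orbT.
  lra.
have : K * normc z <= K * Num.max C 0 by rewrite ler_wpM2l// le_max zC.
have := normc_ge0 (p * 'X + c%:P).[z]; have := normc_ge0 c.
lra.
Qed.

(** Slope [(L + 1) / eta] gives [(L + 1) * normc z <= eta * (L * r + C)], and [r] exceeds [C]. *)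
Lemma poly_small (p : {poly R[i]}) (L eta : R) : (2 < size p)%N ->
  0 <= L -> 0 < eta -> exists M, 0 < M /\ forall r z, M < r ->
  normc p.[z] <= L * r -> normc z <= eta * r.
Proof.
move=> sp L0 e0.
have [|C HC] := poly_superlinear p ((L + 1) / eta) sp.
  by rewrite divr_ge0 ?addr_ge0// ltW.
exists (Num.max C 1); split; first by rewrite lt_max ltr01 orbT.
move=> r z; rewrite gt_max => /andP[Cr r1] pz.
have := HC z; rewrite mulrAC ler_pdivrMr// => h.
have L1 : 0 < L + 1 by lra.
rewrite -(ler_pM2l L1); apply: le_trans h _.
rewrite mulrCA mulrC ler_pM2l//; lra.
Qed.

End Growth.

(** * The four maps far from the origin *)

Section Geometry.
Context {R : realType}.
Variables (P : {poly R[i]}) (delta : R[i]) (theta : R).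
Hypothesis delta0 : delta != 0.

Definition normsq (p : C2 R) : R :=
  p.1.1 ^+ 2 + p.1.2 ^+ 2 + (p.2.1 ^+ 2 + p.2.2 ^+ 2).

Definition step (e : bool * bool) : C2 R -> C2 R :=
  match e with
  | (false, false) => h1 P delta
  | (true, false) => h2 P delta theta
  | (false, true) => h1inv P delta
  | (true, true) => h2inv P delta theta
  end.

Lemma ofCK : cancel (@ofC R) (@toC R).
Proof. by case. Qed.

Lemma toCK : cancel (@toC R) (@ofC R).
Proof. by case. Qed.

Lemma pt_toC (p : C2 R) : pt (toC p.1) (toC p.2) = p.
Proof. by rewrite /pt !toCK -surjective_pairing. Qed.

Lemma rotK : cancel (Defs.rot theta) (rotinv theta).
Proof.
move=> [[a b] [c d]]; rewrite /Defs.rot /rotinv /pt /toC /ofC /=.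
have h := cos2Dsin2 theta.
by congr ((_, _), (_, _)); rewrite -[RHS]mul1r -h; ring.
Qed.

Lemma rotinvK : cancel (rotinv theta) (Defs.rot theta).
Proof.
move=> [[a b] [c d]]; rewrite /Defs.rot /rotinv /pt /toC /ofC /=.
have h := cos2Dsin2 theta.
by congr ((_, _), (_, _)); rewrite -[RHS]mul1r -h; ring.
Qed.

Lemma h1K : cancel (h1 P delta) (h1inv P delta).
Proof.
move=> p; rewrite -[RHS]pt_toC /h1 /h1inv /= !ofCK.
congr (pt _ _); rewrite opprB addrCA subrr addr0 mulrC mulKf//.
Qed.

Lemma h1invK : cancel (h1inv P delta) (h1 P delta).
Proof.
move=> p; rewrite -[RHS]pt_toC /h1 /h1inv /= !ofCK.
by congr (pt _ _); rewrite mulrC divfK// opprB addrCA subrr addr0.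
Qed.

Lemma stepK e : cancel (step e) (step (letter_inv e)).
Proof.
case: e => -[] [] p; rewrite /= /h2 /h2inv /= ?h1K ?h1invK//.
  by rewrite rotinvK h1invK rotK.
by rewrite rotinvK h1K rotK.
Qed.

Lemma normsq_rot p : normsq (Defs.rot theta p) = normsq p.
Proof.
case: p => [[a b] [c d]]; rewrite /Defs.rot /pt /toC /ofC /normsq /=.
have := cos2Dsin2 theta; set u := cos theta; set v := sin theta => h.
rewrite -[RHS]mul1r -h; ring.
Qed.

Lemma normsq_rotinv p : normsq (rotinv theta p) = normsq p.
Proof. by rewrite -normsq_rot rotinvK. Qed.

(** The forms [y] and [v * x + u * y] are independent when [v] is nonzero. The factor [u ^+ 2], at
    most 1, gives all pairs of letters the same constant. *)
Lemma oblique_bound (u v x y : R) : u ^+ 2 + v ^+ 2 = 1 ->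
  u ^+ 2 * v ^+ 2 * (x ^+ 2 + y ^+ 2) <= 3 * (y ^+ 2 + (v * x + u * y) ^+ 2).
Proof.
move=> uv; set f := v * x + u * y.
have u0 := sqr_ge0 u; have v0 := sqr_ge0 v.
have h1 : v ^+ 2 * x ^+ 2 <= 2 * f ^+ 2 + 2 * (u ^+ 2 * y ^+ 2).
  have -> : v ^+ 2 * x ^+ 2 = (f - u * y) ^+ 2 by rewrite /f; ring.
  by have := sqr_ge0 (f + u * y); nra.
have h2 : u ^+ 2 * (v ^+ 2 * (x ^+ 2 + y ^+ 2)) <= v ^+ 2 * (x ^+ 2 + y ^+ 2).
  apply: ler_piMl; last lra.
  by apply: mulr_ge0 => //; apply: addr_ge0; exact: sqr_ge0.
have h3 : 0 <= f ^+ 2 by exact: sqr_ge0.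
have h4 : 0 <= u ^+ 2 * y ^+ 2 by rewrite mulr_ge0 ?sqr_ge0.
have h5 : u ^+ 2 * y ^+ 2 + v ^+ 2 * y ^+ 2 = y ^+ 2 by rewrite -mulrDl uv mul1r.
have h6 : 0 <= v ^+ 2 * y ^+ 2 by rewrite mulr_ge0 ?sqr_ge0.
by rewrite -mulrA; lra.
Qed.

(** Covers a letter and its inverse, whose two forms are orthogonal. *)
Lemma orthogonal_bound (u v s : R) : u ^+ 2 + v ^+ 2 = 1 -> 0 <= s ->
  u ^+ 2 * v ^+ 2 * s <= 3 * s.
Proof.
move=> uv s0; apply: ler_wpM2r => //.
have -> : v ^+ 2 = 1 - u ^+ 2 by rewrite -uv addrAC subrr add0r.
have : 0 <= (u ^+ 2) ^+ 2 by exact: sqr_ge0.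
by have := sqr_ge0 v; rewrite mulrBr mulr1 -expr2; lra.
Qed.

(* The squared modulus of the linear form that must be small, compared with
   the norm of [p], for the letter [e] not to expand [p]. *)
Definition indet (e : bool * bool) (p : C2 R) : R :=
  let p' := if e.1 then Defs.rot theta p else p in
  let z := if e.2 then p'.1 else p'.2 in z.1 ^+ 2 + z.2 ^+ 2.

Lemma indet_separated i j p : i != j ->
  sin theta ^+ 2 * cos theta ^+ 2 * normsq p <= 3 * (indet i p + indet j p).
Proof.
case: p => [[a b] [c d]].
have := cos2Dsin2 theta.
rewrite /indet /Defs.rot /toC /pt /ofC /normsq /=.
set u := cos theta; set v := sin theta => h.
have S := orthogonal_bound u v (a ^+ 2 + b ^+ 2 + (c ^+ 2 + d ^+ 2)) h
  (addr_ge0 (addr_ge0 (sqr_ge0 a) (sqr_ge0 b)) (addr_ge0 (sqr_ge0 c) (sqr_ge0 d))).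
have hS : v ^+ 2 + u ^+ 2 = 1 by rewrite addrC.
have hN : u ^+ 2 + (- v) ^+ 2 = 1 by rewrite sqrrN.
have hNS : (- v) ^+ 2 + u ^+ 2 = 1 by rewrite sqrrN addrC.
(* The rotation is real, so the forms act alike on the real parts [a], [c] and the imaginary parts
   [b], [d]. These bounds serve letters from different generators; [S] and [E] serve a letter and
   its inverse. *)
have A1 := oblique_bound u v a c h; have A2 := oblique_bound u v b d h.
have B1 := oblique_bound v u c a hS; have B2 := oblique_bound v u d b hS.
have C1 := oblique_bound u (- v) c a hN; have C2 := oblique_bound u (- v) d b hN.
have D1 := oblique_bound (- v) u a c hNS; have D2 := oblique_bound (- v) u b d hNS.
have E : (u * a - v * c) ^+ 2 + (u * b - v * d) ^+ 2 +
    ((v * a + u * c) ^+ 2 + (v * b + u * d) ^+ 2) =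
    a ^+ 2 + b ^+ 2 + (c ^+ 2 + d ^+ 2).
  by rewrite -[RHS]mul1r -h; ring.
rewrite sqrrN in C1 C2 D1 D2.
case: i j => -[] [] [[] []] // _ /=;
  rewrite ?(mul0r, mulr0, addr0, subr0, add0r, oppr0).
all: try lra.
Qed.

Local Notation normc := (@Normc.normc R).

Lemma normsq_pt x y : normsq (pt x y) = normc x ^+ 2 + normc y ^+ 2.
Proof. by rewrite !normc_sqr. Qed.

Lemma le_double (a r : R) : 0 <= r -> a ^+ 2 <= 2 * r ^+ 2 -> a <= 2 * r.
Proof. by move=> r0 h; rewrite leNgt; apply/negP => lt; nra. Qed.

Hypothesis sizeP : (2 < size P)%N.

(** If a letter does not expand a point of norm [r], the value of [P] at one coordinate is of order
    [r], so superlinear growth makes that coordinate small against [r]. *)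
Lemma contracting_indet (eta : R) : 0 < eta ->
  exists M, 0 < M /\ forall e p, M < normsq p ->
    normsq (step e p) <= 2 * normsq p -> indet e p <= eta ^+ 2 * normsq p.
Proof.
move=> eta0; have d0 := normc_ge0 _ delta.
(* One constant for both directions: [h1] yields the factor [2 + normc delta], [h1inv] the factor
   [2 * normc delta + 1]. *)
have L0 : 0 <= 2 + 2 * normc delta by lra.
have [M [M0 HM]] := poly_small _ P _ _ sizeP L0 eta0.
exists (M ^+ 2); split; first exact: exprn_gt0.
(* The second generator is conjugate to the first by a rotation, which preserves [normsq]. *)
suff H c p : M ^+ 2 < normsq p -> normsq (step (false, c) p) <= 2 * normsq p ->
    indet (false, c) p <= eta ^+ 2 * normsq p.
  move=> [] [] [] p; try exact: H.
    rewrite -(normsq_rot p) => Mp /=; rewrite /h2inv /= normsq_rotinv.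
    exact: (H true).
  rewrite -(normsq_rot p) => Mp /=; rewrite /h2 /= normsq_rotinv.
  exact: (H false).
rewrite -(pt_toC p); move: (toC p.1) (toC p.2) => x y {p}.
rewrite normsq_pt.
set r := Num.sqrt (normc x ^+ 2 + normc y ^+ 2).
have r0 : 0 <= r by exact: sqrtr_ge0.
have r2 : normc x ^+ 2 + normc y ^+ 2 = r ^+ 2.
  by rewrite sqr_sqrtr// addr_ge0 ?sqr_ge0.
rewrite r2 ltr_pXn2r ?nnegrE// ?(ltW M0)// => Mr.
have x0 := normc_ge0 _ x; have y0 := normc_ge0 _ y.
have xr : normc x <= r by rewrite leNgt; apply/negP => lt; nra.
have yr : normc y <= r by rewrite leNgt; apply/negP => lt; nra.
have fin z : normc P.[z] <= (2 + 2 * normc delta) * r ->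
    normc z ^+ 2 <= eta ^+ 2 * r ^+ 2.
  move=> /(HM _ _ Mr) zr; rewrite -exprMn ler_pXn2r ?nnegrE ?normc_ge0//.
  by rewrite mulr_ge0// ltW.
case: c => /=.
- rewrite /h1inv /= !ofCK normsq_pt => h.
  rewrite /indet /= -(normc_sqr _ x); apply: fin.
  have : normc ((P.[x] - y) / delta) <= 2 * r.
    by apply: le_double => //; have := sqr_ge0 (normc x); lra.
  have dp : 0 < normc delta.
    rewrite lt_neqAle d0 andbT eq_sym; apply: contra delta0.
    by move=> /eqP/Normc.eq0_normc ->.
  rewrite Normc.normcM Normc.normcV ler_pdivrMr// => h'.
  by have := normc_subr _ P.[x] y; nra.
- rewrite /h1 /= !ofCK normsq_pt => h.
  rewrite /indet /= -(normc_sqr _ y); apply: fin.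
  have : normc (P.[y] - delta * x) <= 2 * r.
    by apply: le_double => //; have := sqr_ge0 (normc y); lra.
  have := normc_subr _ P.[y] (delta * x); rewrite Normc.normcM.
  have : normc delta * normc x <= normc delta * r by rewrite ler_wpM2l.
  nra.
Qed.

Hypotheses (sin0 : sin theta != 0) (cos0 : cos theta != 0).

(** Two non-expanding letters would make two separated forms small at once, forcing
    [k * normsq p <= 6 * eta ^+ 2 * normsq p]. *)
Lemma step_expand : exists M, 0 < M /\ forall p i j, M < normsq p -> i != j ->
  normsq (step i p) <= 2 * normsq p -> 2 * normsq p < normsq (step j p).
Proof.
pose k := sin theta ^+ 2 * cos theta ^+ 2.
have k0 : 0 < k by rewrite mulr_gt0// exprn_even_gt0.
(* As [eta <= 1], this gives [eta ^+ 2 <= eta <= k / 7], hence [6 * eta ^+ 2 < k]. *)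
pose eta := Num.min 1 (k / 7).
have eta0 : 0 < eta by rewrite lt_min ltr01 divr_gt0.
have etak : 6 * eta ^+ 2 < k.
  have : eta <= 1 by rewrite ge_min lexx.
  have : eta <= k / 7 by rewrite ge_min lexx orbT.
  by nra.
have [M [M0 HM]] := contracting_indet eta eta0.
exists M; split => // p i j Mp ij si.
rewrite ltNge; apply/negP => sj.
have := indet_separated i j p ij; rewrite -/k.
have := HM _ _ Mp si; have := HM _ _ Mp sj.
have : 6 * eta ^+ 2 * normsq p < k * normsq p by rewrite ltr_pM2r//; lra.
lra.
Qed.

End Geometry.

(** * Measurability and stationarity *)

Section Measurability.
Context {R : realType} {d : measure_display} {T : measurableType d}.

Local Notation Re := (@complex.Re R).
Local Notation Im := (@complex.Im R).

(** Real and imaginary parts are the coordinates in which [C2] carries its product sigma-algebra. *)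
Definition cmeasurable (f : T -> R[i]) :=
  measurable_fun setT (Re \o f) /\ measurable_fun setT (Im \o f).

Lemma cmeasurable_cst z : cmeasurable (fun=> z).
Proof. by split; exact: measurable_cst. Qed.

Lemma cmeasurableD f g : cmeasurable f -> cmeasurable g ->
  cmeasurable (fun x => f x + g x).
Proof.
move=> [f1 f2] [g1 g2]; split.
  rewrite [X in measurable_fun _ X](_ : _ = (Re \o f) \+ (Re \o g)).
    exact: measurable_funD.
  by apply/funext => x /=; case: (f x) => ? ?; case: (g x).
rewrite [X in measurable_fun _ X](_ : _ = (Im \o f) \+ (Im \o g)).
  exact: measurable_funD.
by apply/funext => x /=; case: (f x) => ? ?; case: (g x).
Qed.

Lemma cmeasurableM f g : cmeasurable f -> cmeasurable g ->
  cmeasurable (fun x => f x * g x).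
Proof.
move=> [f1 f2] [g1 g2]; split.
  rewrite [X in measurable_fun _ X](_ : _ =
     ((Re \o f) \* (Re \o g)) \- ((Im \o f) \* (Im \o g))).
    by apply: measurable_funB; exact: measurable_funM.
  by apply/funext => x /=; case: (f x) => ? ?; case: (g x).
rewrite [X in measurable_fun _ X](_ : _ =
   ((Re \o f) \* (Im \o g)) \+ ((Im \o f) \* (Re \o g))).
  by apply: measurable_funD; exact: measurable_funM.
by apply/funext => x /=; case: (f x) => ? ?; case: (g x).
Qed.

Lemma cmeasurableN f : cmeasurable f -> cmeasurable (fun x => - f x).
Proof.
move=> mf; under eq_fun do rewrite -mulN1r.
by apply: cmeasurableM => //; exact: cmeasurable_cst.
Qed.

Lemma cmeasurable_horner (p : {poly R[i]}) f : cmeasurable f ->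
  cmeasurable (fun x => p.[f x]).
Proof.
move=> mf; elim/poly_ind: p => [|p c IH].
  by under eq_fun do rewrite horner0; exact: cmeasurable_cst.
under eq_fun do rewrite hornerMXaddC.
by apply: cmeasurableD; [exact: cmeasurableM|exact: cmeasurable_cst].
Qed.

Lemma measurable_pt f g : cmeasurable f -> cmeasurable g ->
  measurable_fun setT (fun x => pt (f x) (g x)).
Proof.
move=> [f1 f2] [g1 g2].
by apply: measurable_fun_pair; apply: measurable_fun_pair.
Qed.

End Measurability.

Section StepMeasurability.
Context {R : realType}.
Variables (P : {poly R[i]}) (delta : R[i]) (theta : R).

Lemma cmeasurable_fst : cmeasurable (fun p : C2 R => toC p.1).
Proof.
by split; [apply: (measurableT_comp measurable_fst measurable_fst)|
  apply: (measurableT_comp measurable_snd measurable_fst)].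
Qed.

Lemma cmeasurable_snd : cmeasurable (fun p : C2 R => toC p.2).
Proof.
by split; [apply: (measurableT_comp measurable_fst measurable_snd)|
  apply: (measurableT_comp measurable_snd measurable_snd)].
Qed.

Local Hint Resolve cmeasurable_fst cmeasurable_snd cmeasurable_cst : core.

Lemma measurable_step e : measurable_fun setT (step P delta theta e).
Proof.
have m1 : measurable_fun setT (h1 P delta).
  apply: measurable_pt => //; apply: cmeasurableD; first exact: cmeasurable_horner.
  by apply: cmeasurableN; exact: cmeasurableM.
have m2 : measurable_fun setT (h1inv P delta).
  apply: measurable_pt => //; apply: cmeasurableM => //.
  by apply: cmeasurableD; [exact: cmeasurable_horner|exact: cmeasurableN].
have m3 : measurable_fun setT (@Defs.rot R theta).
  by apply: measurable_pt; apply: cmeasurableD; try apply: cmeasurableN;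
    exact: cmeasurableM.
have m4 : measurable_fun setT (@rotinv R theta).
  by apply: measurable_pt; apply: cmeasurableD; exact: cmeasurableM.
case: e => -[] [] //; apply: measurableT_comp => //; exact: measurableT_comp.
Qed.

Lemma measurable_normsq : measurable_fun setT (@normsq R).
Proof.
have [m1 m2] := cmeasurable_fst; have [m3 m4] := cmeasurable_snd.
by apply: measurable_funD; apply: measurable_funD; exact: measurable_funX.
Qed.

Lemma normsq_continuous : continuous (@normsq R).
Proof.
have cfst (T U : topologicalType) : continuous (@fst T U) by move=> x; exact: cvg_fst.
have csnd (T U : topologicalType) : continuous (@snd T U) by move=> x; exact: cvg_snd.
have sq (f : C2 R -> R) : continuous f -> continuous (fun p => f p ^+ 2).
  move=> cf p; apply: (@continuous_comp _ _ _ f (fun y : R => y ^+ 2)).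
    exact: cf.
  exact: exprn_continuous.
move=> p; apply: cvgD; apply: cvgD.
- by apply: (sq (fun p => p.1.1)) => x; apply: continuous_comp; exact: cfst.
- by apply: (sq (fun p => p.1.2)) => x; apply: continuous_comp;
    [exact: cfst|exact: csnd].
- by apply: (sq (fun p => p.2.1)) => x; apply: continuous_comp;
    [exact: csnd|exact: cfst].
- by apply: (sq (fun p => p.2.2)) => x; apply: continuous_comp; exact: csnd.
Qed.

Lemma normsq_le_compact (M : R) : compact [set p : C2 R | normsq p <= M].
Proof.
(* With [m] at least 1, [t ^+ 2 <= m] confines [t] to [[- m, m]] without a square root. *)
pose m := Num.max M 1.
pose I := `[- m, m]%classic.
have cI : compact I by exact: segment_compact.
apply: (@subclosed_compact _ _ ((I `*` I) `*` (I `*` I))).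
- rewrite [X in closed X](_ : _ = normsq @^-1` [set x | x <= M]) //.
  apply: preimage_closed; last exact: closed_le.
  by move=> p _; exact: normsq_continuous.
- by apply: compact_setX; apply: compact_setX.
- move=> [[a b] [c e]]; rewrite /normsq /= => h.
  have bnd (t : R) : t ^+ 2 <= m -> t \in `[- m, m].
    have : 1 <= m by rewrite le_max lexx orbT.
    move=> m1 tm; rewrite in_itv /=.
    by apply/andP; split; rewrite leNgt; apply/negP => lt; nra.
  have Mm : M <= m by rewrite le_max lexx.
  have := sqr_ge0 a; have := sqr_ge0 b; have := sqr_ge0 c; have := sqr_ge0 e.
  move=> e2 c2 b2 a2.
  by split; split; apply: bnd; lra.
Qed.

Lemma supp_closed (mu : set (C2 R) -> \bar R) : closed (supp mu).
Proof.
rewrite -[X in closed X]setCK; apply: open_closedC.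
rewrite openE => x /= /existsNP[U] /not_implyP[oU] /not_implyP[Ux nmu].
apply: (filterS _ (open_nbhs_nbhs (conj oU Ux))) => y Uy.
by move=> /(_ U oU Uy).
Qed.

HB.instance Definition _ e :=
  isMeasurableFun.Build _ _ _ _ (step P delta theta e) (measurable_step e).

Section Integral.
Variables (a1 a2 a3 a4 : R) (mu : probability (C2 R) R).

Definition letter_mass (e : bool * bool) :=
  match e with
  | (false, false) => a1
  | (true, false) => a2
  | (false, true) => a3
  | (true, true) => a4
  end.

Hypothesis mass_gt0 : forall e, 0 < letter_mass e.
Hypothesis stat : stationary P delta theta a1 a2 a3 a4 mu.

(** By [stat], [mu] is a sum of four scaled pushforwards; integrate [f] against it and change
    variables. As [f] is nonnegative, linearity requires no integrability. *)
Lemma stationary_integral (f : C2 R -> R) : measurable_fun setT f ->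
  (forall x, 0 <= f x <= 1) ->
  (\int[mu]_x (f x)%:E =
   \int[mu]_x (\sum_e letter_mass e * f (step P delta theta e x))%:E)%E.
Proof.
move=> mf f01.
have f0 x : (0 <= (f x)%:E)%E by rewrite lee_fin; have /andP[] := f01 x.
have mEf : measurable_fun setT (EFin \o f) by exact/measurable_EFinP.
pose m e := mscale (NngNum (ltW (mass_gt0 e)))
  (distribution mu (step P delta theta e)).
pose g e x := letter_mass e * f (step P delta theta e x).
have g0 e x : 0 <= g e x.
  by apply: mulr_ge0; [exact: ltW|have /andP[] := f01 (step P delta theta e x)].
have mg e : measurable_fun setT (g e).
  apply: measurable_funM => //.
  by apply: measurableT_comp => //; exact: measurable_step.
have mE e : (\int[m e]_x (f x)%:E =
    \int[mu]_x (g e x)%:E)%E.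
  have mfe : measurable_fun setT (f \o step P delta theta e).
    by apply: measurableT_comp => //; exact: measurable_step.
  rewrite ge0_integral_mscale// ge0_integral_distribution//.
  rewrite -ge0_integralZl_EFin//.
  - by move=> x _; exact: f0.
  - exact/measurable_EFinP.
(* The binary [measure_add] pairs the two generators and the two inverses; [addeA] matches this with
   the left-nested sum in [stationary]. *)
pose m13 := measure_add (m (false, false)) (m (true, false)).
pose m24 := measure_add (m (false, true)) (m (true, true)).
transitivity (\int[measure_add m13 m24]_x (f x)%:E)%E.
  apply: eq_measure_integral => A mA _.
  transitivity (m13 A + m24 A)%E; last by symmetry; exact: measure_addE.
  transitivity (m (false, false) A + m (true, false) A
    + (m (false, true) A + m (true, true) A))%E.
    by rewrite addeA; exact: stat.
  by congr (_ + _)%E; symmetry; exact: measure_addE.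
rewrite !ge0_integral_measure_add// !mE.
have intD (u v : C2 R -> R) : measurable_fun setT u -> measurable_fun setT v ->
    (forall x, 0 <= u x) -> (forall x, 0 <= v x) ->
    (\int[mu]_x (u x)%:E + \int[mu]_x (v x)%:E = \int[mu]_x (u x + v x)%:E)%E.
  move=> mu' mv u0 v0; rewrite -ge0_integralD//.
  - by move=> x _; rewrite lee_fin.
  - exact/measurable_EFinP.
  - by move=> x _; rewrite lee_fin.
  - exact/measurable_EFinP.
have mgg e e' : measurable_fun setT (fun x => g e x + g e' x).
  exact: measurable_funD.
have gg0 e e' x : 0 <= g e x + g e' x by exact: addr_ge0.
rewrite !intD//.
apply: eq_integral => x _; congr EFin.
by rewrite /g (sum_letters _ _ (false, false)) /letter_inv /=; ring.
Qed.

Lemma letter_mass_sum : a1 + a2 + a3 + a4 = 1 -> \sum_e letter_mass e = 1.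
Proof. by move=> h; rewrite (sum_letters _ _ (false, false)) /=; lra. Qed.

End Integral.
End StepMeasurability.

(** * The condition on the angle, and the theorem *)

Lemma sin_cos_neq0 (R : realType) (theta : R) : 0 < theta < 2 * pi ->
  theta != pi / 2 -> theta != pi -> theta != 3 * pi / 2 ->
  sin theta != 0 /\ cos theta != 0.
Proof.
move=> /andP[t0 t2] n1 n2 n3; have p0 := pi_gt0 R.
have sinpos (x : R) : 0 < x < pi -> sin x != 0 by move=> /sin_gt0_pi/gt_eqF ->.
have sin_neq0 (x : R) : 0 < x < 2 * pi -> x != pi -> sin x != 0.
  move=> /andP[x0 x2] xpi; case: (ltgtP x pi) => [lt|gt|/eqP].
  - by apply: sinpos; rewrite x0.
  - rewrite -(subrK pi x) sinDpi oppr_eq0; apply: sinpos; apply/andP; split; lra.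
  - by rewrite (negbTE xpi).
split; first by apply: sin_neq0 => //; rewrite t0.
(* The cosine is a sine shifted by a quarter turn; past [3 * pi / 2] the shifted angle exceeds
   [2 * pi], and a full turn is removed. *)
rewrite -sinDpihalf.
have [lt|gt|/eqP] := ltgtP theta (3 * pi / 2); last by rewrite (negbTE n3).
  apply: sin_neq0; first by apply/andP; split; lra.
  by apply: contra n1 => /eqP h; apply/eqP; lra.
have -> : theta + pi / 2 = (theta - 3 * pi / 2) + pi *+ 2.
  by rewrite (mulr2n pi); field.
by rewrite sinD2pi; apply: sinpos; apply/andP; split; lra.
Qed.

Theorem theoremB (R : realType) (P : {poly R[i]}) (delta : R[i]) (theta : R)
    (a1 a2 a3 a4 : R) (mu : probability (C2 R) R) :
  (2 <= (size P).-1)%N ->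
  delta != 0 ->
  0 < theta < 2 * pi ->
  theta != pi / 2 -> theta != pi -> theta != 3 * pi / 2 ->
  0 < a1 -> 0 < a2 -> 0 < a3 -> 0 < a4 ->
  a1 + a2 + a3 + a4 = 1 ->
  stationary P delta theta a1 a2 a3 a4 mu ->
  compact (supp mu).
Proof.
move=> sP d0 th n1 n2 n3 a10 a20 a30 a40 asum stat.
have [s0 c0] := sin_cos_neq0 _ _ th n1 n2 n3.
(* The degree is [(size P).-1], so degree at least 2 means size at least 3. *)
have {}sP : (2 < size P)%N by move: sP; case: (size P).
have mass0 e : 0 < letter_mass a1 a2 a3 a4 e by case: e => -[] [].
have mass1 := letter_mass_sum _ _ _ _ asum.
have [q [q01 drift]] := drift_weights _ _ mass0 mass1.
have [M [M0 expand]] := step_expand _ _ _ d0 sP s0 c0.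
have null : mu [set p | M < normsq p] = 0%E.
  apply: (@stationary_null _ _ _ _ (step P delta theta) letter_inv _ _ q
    (letter_mass a1 a2 a3 a4)) => //.
  - exact: letter_invK.
  - exact: stepK.
  - exact: measurable_normsq.
  - exact: stationary_integral.
(* A support point outside this ball would give positive mass to the open null set
   [M < normsq p]. *)
apply: (subclosed_compact _ (normsq_le_compact M)); first exact: supp_closed.
move=> p sp /=; rewrite leNgt; apply/negP => Mp.
have oF : open [set p : C2 R | M < normsq p].
  apply: (@open_comp _ _ (@normsq R) [set x | M < x]); last exact: open_gt.
  by move=> x _; exact: normsq_continuous.
by have := sp _ oF Mp; rewrite null ltxx.
Qed.
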